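(* Let $(\beta,\mathcal{A})$ be a numeration system such that $1\in\mathcal{A}[\beta]$ and $\mathcal{A}\subset\mathbb{Z}[\beta]$. If $(\beta,\mathcal{A})$ allows parallel addition without anticipation, then $\beta$ is expanding, i.e., $\beta$ is an algebraic number with all conjugates greater than $1$ in modulus.
   Context: $\mathbb{N}$ contains $0$. $\mathbb{Z}[\beta]$ is the smallest ring containing $\mathbb{Z}$ and $\beta$. The conjugates of an algebraic number are all complex roots of its minimal polynomial over $\mathbb{Q}$ (including the number itself). A numeration system is a pair $(\beta,\mathcal{A})$ where $\beta\in\mathbb{C}$, $|\beta|>1$ (the base), and $\mathcal{A}\subset\mathbb{C}$ is a finite set containing $0$ (the alphabet). Define $\mathcal{A}[\beta]=\{\sum_{j=0}^n x_j\beta^j : n\in\mathbb{N},\ x_j\in\mathcal{A}\}$. For alphabets $\mathcal{A},\mathcal{B}$, a function $\varphi:\mathcal{B}^{\mathbb{Z}}\to\mathcal{A}^{\mathbb{Z}}$ is $p$-local if there exist $r,t\in\mathbb{N}$ with $p=r+t+1$ and a function $\phi:\mathcal{B}^p\to\mathcal{A}$ such that for every $w=(w_j)_{j\in\mathbb{Z}}\in\mathcal{B}^{\mathbb{Z}}$ its image $z=\varphi(w)=(z_j)_{j\in\mathbb{Z}}$ satisfies $z_j=\phi(w_{j+t},\dots,w_{j-r})$ for all $j\in\mathbb{Z}$. The parameter $t$ is called anticipation and $r$ memory. A digit set conversion in base $\beta$ from $\mathcal{B}$ to $\mathcal{A}$ (alphabets containing $0$) is a function $\varphi:\mathcal{B}^{\mathbb{Z}}\to\mathcal{A}^{\mathbb{Z}}$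 such that for every $w=(w_j)_{j\in\mathbb{Z}}\in\mathcal{B}^{\mathbb{Z}}$ with finitely many non-zero digits, $z=\varphi(w)$ has only finitely many non-zero digits and $\sum_{j\in\mathbb{Z}}w_j\beta^j=\sum_{j\in\mathbb{Z}}z_j\beta^j$. Parallel addition in $(\beta,\mathcal{A})$ is a digit set conversion in base $\beta$ from $\mathcal{A}+\mathcal{A}=\{a+a' : a,a'\in\mathcal{A}\}$ to $\mathcal{A}$ that is $p$-local for some $p\in\mathbb{N}$. It is without anticipation if it is $p$-local with $p=r+1$, i.e. with $t=0$, so that $z_j=\phi(w_j,\dots,w_{j-r})$ for all $j$. *)

(* Defs.v *)
From HB Require Import structures.
From mathcomp Require Import all_boot all_order all_algebra finmap complex.
From mathcomp Require Import boolp classical_sets cardinality fsbigop reals.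

Set Implicit Arguments.
Unset Strict Implicit.
Unset Printing Implicit Defensive.

Import Order.TTheory GRing.Theory Num.Theory.

Local Open Scope classical_set_scope.
Local Open Scope fset_scope.
Local Open Scope ring_scope.

Section Numeration.
Variable R : realType.
Local Notation C := (R[i]).
Implicit Types (beta gamma x : C) (A B : {fset C}).

(* The order of C only compares numbers with the same imaginary part, and
   `|beta| is a real element of C. *)
Definition numeration_system beta A : Prop := 1 < `|beta| /\ 0 \in A.

Definition in_base_expansions A beta x : Prop :=
  exists (n : nat) (d : 'I_n.+1 -> A), x = \sum_(j < n.+1) val (d j) * beta ^+ j.

(* Z[beta] as the intersection of all subrings of C containing beta (a subring
   contains 1, hence Z). *)
Definition in_Zadjoin beta x : Prop :=
  forall S : {pred C}, GRing.subring_closed S -> beta \in S -> x \in S.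

Definition sumset A B : {fset C} := [fset a + b | a in A, b in B].

Definition is_local_with B A (r t : nat) (f : (int -> B) -> (int -> A)) : Prop :=
  exists phi : (r + t + 1).-tuple B -> A, forall (w : int -> B) (j : int),
    f w j = phi [tuple w (j + t%:Z - i%:Z) | i < r + t + 1].

Definition is_local B A (p : nat) (f : (int -> B) -> (int -> A)) : Prop :=
  exists r t : nat, p = (r + t + 1)%N /\ is_local_with r t f.

Definition finitely_many_nonzero A (w : int -> A) : Prop :=
  finite_set [set j : int | val (w j) != 0].

(* The finitely supported sum over Z: it has its intended meaning when w has
   finitely many nonzero digits (and is 0 by convention otherwise). *)
Definition word_value beta A (w : int -> A) : C :=
  \sum_(j \in [set: int]) (val (w j) * beta ^ j).

Definition digit_set_conversion beta B A (f : (int -> B) -> (int -> A)) : Prop :=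
  forall w : int -> B, finitely_many_nonzero w ->
    finitely_many_nonzero (f w) /\ word_value beta w = word_value beta (f w).

Definition parallel_addition beta A
    (f : (int -> sumset A A) -> (int -> A)) : Prop :=
  digit_set_conversion beta f /\ exists p : nat, is_local p f.

Definition without_anticipation B A (f : (int -> B) -> (int -> A)) : Prop :=
  exists r : nat, is_local_with r 0 f.

Definition allows_parallel_addition_without_anticipation beta A : Prop :=
  exists f : (int -> sumset A A) -> (int -> A),
    parallel_addition beta f /\ without_anticipation f.

Definition is_minimal_polynomial beta (p : {poly rat}) : Prop :=
  [/\ p \is monic, root (map_poly ratr p) beta
    & forall q : {poly rat}, q != 0 -> root (map_poly ratr q) beta ->
        (size p <= size q)%N].

Definition conjugate beta gamma : Prop :=
  exists2 p : {poly rat}, is_minimal_polynomial beta p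
    & root (map_poly ratr p) gamma.

Definition expanding beta : Prop :=
  algebraicOver (ratr : rat -> C) beta /\
  forall gamma, conjugate beta gamma -> 1 < `|gamma|.

End Numeration.

(* Main.v *)
Require Import Defs.
From mathcomp Require Import all_boot all_order all_algebra finmap complex.
From mathcomp Require Import boolp classical_sets cardinality fsbigop.
From mathcomp Require Import reals.

Import Order.TTheory GRing.Theory Num.Theory.

Local Open Scope ring_scope.

(** The idea is that every integer polynomial relation satisfied by [beta] can
    be transported to a conjugate [gamma], while the digits, being finitely
    many polynomials in [beta], stay bounded after the transport.

    A conversion without anticipation maps the zero word to the zero word (a
    constant word with finitely many nonzero digits vanishes), so it cannot
    create digits at negative positions.  Hence the values of nonnegative-
    position expansions are closed under addition ([expansions_add]), and since
    1 is such a value, so is every natural number ([expansions_nat]).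

    Call [gamma] a specialization of [beta] when every rational polynomial
    vanishing at [beta] vanishes at [gamma].  Writing
    [n = x_0 + x_1 beta + ... + x_m beta^m] and replacing [beta] by [gamma] in
    the digits and in the powers gives [n = y_0 + y_1 gamma + ...] with the
    [y_j] in a finite set independent of [n].  If [|gamma| < 1] the right-hand
    side is bounded by a geometric series, which is absurd for large [n]; thus
    [|gamma| >= 1] for every specialization ([specialization_norm_ge1]).

    Everything follows from this single inequality.  If [beta] were
    transcendental, 0 would be a specialization.  So [beta] is algebraic, its
    conjugates are specializations, and they have modulus at least 1.  If a
    conjugate [gamma] had modulus exactly 1, its complex conjugate
    [1 / gamma] would also be a conjugate; the minimal polynomial would share a
    root with its reciprocal, so that [1 / beta] would be a conjugate too,
    although its modulus is less than 1. *)

(** * Reciprocal polynomials and complex conjugation *)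

(** The coefficients are reversed relative to [size p], so that a root at 0
    lowers the degree instead of requiring a shift. *)
Definition reciprocal (F : nzRingType) (p : {poly F}) : {poly F} :=
  \poly_(i < size p) p`_(size p - i.+1).

Lemma horner_reciprocal (F : fieldType) (p : {poly F}) (x : F) : x != 0 ->
  (reciprocal F p).[x] = x ^+ (size p).-1 * p.[x^-1].
Proof.
move=> x0; rewrite horner_poly horner_coef mulr_sumr.
rewrite (reindex_inj rev_ord_inj) /=; apply: eq_bigr => i _.
case: i => i lip /=; rewrite subnSK // subKn ?(ltnW lip) //.
rewrite mulrCA exprVn -exprB ?unitfE //; last by case: (size p) lip.
by congr (_ * _ ^+ _); rewrite subnS -!subn1 subnAC.
Qed.

Lemma map_reciprocal (F K : fieldType) (f : {rmorphism F -> K}) p :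
  map_poly f (reciprocal F p) = reciprocal K (map_poly f p).
Proof.
apply/polyP=> i; rewrite coef_map [(reciprocal _ p)`_i]coef_poly [RHS]coef_poly.
rewrite size_map_poly.
by case: ifP => _; rewrite ?coef_map ?raddf0.
Qed.

Lemma reciprocal_root (K : numFieldType) (p : {poly rat}) (x : K) : x != 0 ->
  root (map_poly ratr (reciprocal _ p)) x = root (map_poly ratr p) x^-1.
Proof.
move=> x0; rewrite map_reciprocal !rootE horner_reciprocal //.
by rewrite mulf_eq0 expf_eq0 (negPf x0) andbF.
Qed.

Lemma conj_root (K : numClosedFieldType) (p : {poly rat}) (x : K) :
  root (map_poly ratr p) x -> root (map_poly ratr p) x^*.
Proof.
move=> /(rmorph_root (Num.conj : {rmorphism K -> K})).
by rewrite -map_poly_comp (eq_map_poly (fmorph_rat _)).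
Qed.

(** * Specializations of a number *)

(** Equivalently, [b |-> g] extends to a ring morphism from [Q[b]] to [K].  This
    covers conjugates of an algebraic number and, when [b] is transcendental,
    all numbers. *)
Definition specialization (K : numFieldType) (b g : K) : Prop :=
  forall q : {poly rat}, root (map_poly ratr q) b -> root (map_poly ratr q) g.

Lemma root_ratrM (K : numFieldType) (p q : {poly rat}) (x : K) :
  root (map_poly ratr (p * q)) x =
  root (map_poly ratr p) x || root (map_poly ratr q) x.
Proof. by rewrite rmorphM rootM. Qed.

Section MinimalPolynomial.
Variables (K : numFieldType) (b g : K) (p : {poly rat}).
Hypotheses (p0 : p != 0) (pb : root (map_poly ratr p) b).
Hypothesis min : forall q : {poly rat}, q != 0 -> root (map_poly ratr q) b ->
  (size p <= size q)%N.
Hypothesis pg : root (map_poly ratr p) g.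

(** The remainder of [q] modulo [p] vanishes at [b] and is smaller than [p], so
    it is zero. *)
Lemma minimal_specialization : specialization _ b g.
Proof.
move=> q qb; suff /dvdpP[s ->] : p %| q by rewrite root_ratrM pg orbT.
rewrite /dvdp; apply: contraT => /min; rewrite leqNgt ltn_modp p0.
apply; move: qb; rewrite {1}(divp_eq q p) rmorphD rmorphM /= !rootE hornerD hornerM.
by rewrite (rootP pb) mulr0 add0r.
Qed.

(** Conjugacy is symmetric: the gcd of [p] and [q] vanishes at [g], hence is not
    constant, so that its cofactor in [p] is too small to vanish at [b].  Hence
    the gcd vanishes at [b], and so does its multiple [q]. *)
Lemma minimal_specialization_sym : specialization _ g b.
Proof.
move=> q qg.
have [d [/dvdpP[s ps] /dvdpP[t ->] dg]] :
    exists d, [/\ d %| p, d %| q & root (map_poly ratr d) g].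
  by exists (gcdp p q); rewrite dvdp_gcdl dvdp_gcdr gcdp_map root_gcd pg qg.
have sd0 : (s != 0) && (d != 0) by rewrite -negb_or -mulf_eq0 -ps.
case/andP: sd0 => s0 d0.
rewrite root_ratrM; apply/orP; right.
move: pb; rewrite ps root_ratrM => /orP[sb|//].
have d1 : (1 < size d)%N.
  by rewrite -(size_map_poly (ratr : {rmorphism rat -> K})) (root_size_gt1 _ dg) ?map_poly_eq0.
have : (size s < size p)%N.
  by rewrite ps (size_mul s0 d0) -subn1 ltn_subRL addnC ltn_add2l.
by rewrite ltnNge (min s s0 sb).
Qed.

End MinimalPolynomial.

(** * Specializations have modulus at least 1 *)

Lemma complex_nat_unbounded (R : realType) (K : R[i]) :
  (forall n : nat, n%:R <= K) -> False.
Proof.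
move=> H; have := H (Num.truncn (complex.Re K)).+1.
rewrite -(rmorph_nat (real_complex R)) lecE /= => /andP[_].
by rewrite leNgt truncnS_gt.
Qed.

Section Digits.
Variables (R : realType) (b : R[i]) (A : {fset R[i]}).
Hypothesis (A0 : 0 \in A).

Lemma Zadjoin_poly x : in_Zadjoin b x ->
  exists q : {poly rat}, x = (map_poly ratr q).[b].
Proof.
move=> /(_ [pred x | `[< exists q : {poly rat}, x = (map_poly ratr q).[b] >]]).
move=> H; apply/asboolP; apply: H.
- split=> [|x' y' /asboolP[p ->] /asboolP[q ->]|x' y' /asboolP[p ->] /asboolP[q ->]];
    apply/asboolP.
  + by exists 1; rewrite rmorph1 hornerE.
  + by exists (p - q); rewrite rmorphB !hornerE.
  + by exists (p * q); rewrite rmorphM !hornerE.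
- by apply/asboolP; exists 'X; rewrite map_polyX hornerX.
Qed.

(** If [|g| < 1], transporting an expansion of [n] from [b] to [g] bounds [n] by
    [M / (1 - |g|)], with [M] depending only on the alphabet. *)
Lemma specialization_norm_ge1 (g : R[i]) :
  (forall a, a \in A -> in_Zadjoin b a) ->
  (forall n : nat, in_base_expansions A b n%:R) ->
  specialization _ b g -> 1 <= `|g|.
Proof.
move=> hA hN sp.
rewrite real_leNgt ?realE ?normr_ge0 ?ler01 //; apply/negP => g1.
have /choice[P hP] : forall a : A, exists q : {poly rat},
    val a = (map_poly ratr q).[b].
  by move=> a; apply/Zadjoin_poly/hA/valP.
(* A sum rather than a maximum over the alphabet: it also bounds each term. *)
pose e a := `|(map_poly ratr (P a)).[g]| : R[i].
pose M := \sum_a e a.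
apply: (complex_nat_unbounded _ (M / (1 - `|g|))) => n.
rewrite ler_pdivlMr ?subr_gt0 //.
have [m [d hd]] := hN n.
pose q := \sum_(j < m.+1) P (d j) * 'X^j - n%:R.
have qE z : (map_poly ratr q).[z]
    = \sum_(j < m.+1) (map_poly ratr (P (d j))).[z] * z ^+ j - n%:R :> R[i].
  rewrite rmorphB rmorph_nat rmorph_sum hornerD hornerN horner_sum hornerMn hornerC.
  congr (_ - _); apply: eq_bigr => j _.
  by rewrite rmorphM /= map_polyXn hornerM hornerXn.
have : root (map_poly ratr q) b.
  by rewrite rootE qE subr_eq0 hd; apply/eqP/eq_bigr => j _; rewrite -hP.
move/sp; rewrite rootE qE subr_eq0 => /eqP hg.
have hn : n%:R <= M * \sum_(j < m.+1) `|g| ^+ j.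
  rewrite -normr_nat -hg (le_trans (ler_norm_sum _ _ _)) // mulr_sumr.
  apply: ler_sum => j _.
  rewrite normrM normrX ler_wpM2r ?exprn_ge0 // /M (bigD1 (d j)) //= lerDl sumr_ge0 // => *.
  exact: normr_ge0.
have g10 : 0 <= 1 - `|g| by rewrite subr_ge0 ltW.
apply: (le_trans (ler_wpM2r g10 hn)); rewrite -mulrA.
rewrite (_ : (\sum_(j < m.+1) `|g| ^+ j) * (1 - `|g|) = 1 - `|g| ^+ m.+1); last first.
  rewrite -[1 in RHS](expr1n _ m.+1) subrXX mulrC; congr (_ * _).
  by apply: eq_bigr => i _; rewrite expr1n mul1r.
rewrite ler_piMr ?gerBl ?exprn_ge0 //.
by apply: sumr_ge0 => a _; apply: normr_ge0.
Qed.

(** * Closure of expansions under addition *)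

Definition supported (B : {fset R[i]}) (N : nat) (w : int -> B) : Prop :=
  forall j : int, ~~ (0 <= j < N%:Z) -> val (w j) = 0.

Lemma word_value_supported (B : {fset R[i]}) N (w : int -> B) :
  supported B N w -> word_value b w = \sum_(i < N) val (w i%:Z) * b ^+ i.
Proof.
move=> sw; rewrite /word_value (fsbigE (map Posz (iota 0 N))) //.
- rewrite (eq_bigl xpredT); last by move=> j; rewrite in_setT.
  by rewrite big_map -[N in iota 0 N]subn0 big_mkord.
- by rewrite map_inj_uniq ?iota_uniq // => i j [].
- move=> j _ jN; rewrite sw ?mul0r //; apply: contra jN.
  case: j => // i; rewrite lez_nat ltz_nat /= => iN.
  by apply: map_f; rewrite mem_iota.
Qed.

(** Padding by the digit 0 lets two expansions be compared at a common length. *)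
Lemma expansion_digits x : in_base_expansions A b x ->
  exists (N : nat) (d : nat -> A), (forall i, (N <= i)%N -> val (d i) = 0) /\
    forall M, (N <= M)%N -> x = \sum_(i < M) val (d i) * b ^+ i.
Proof.
case=> n [d ->].
pose e i := oapp d [` A0]%fset (insub i); exists n.+1, e.
have e0 i : (n.+1 <= i)%N -> val (e i) = 0.
  by move=> ni; rewrite /e insubF // ltnNge ni.
split=> // M nM.
rewrite (eq_bigr (fun i : 'I__ => val (e i) * b ^+ i)); last first.
  by move=> i _; rewrite /e valK.
rewrite (big_ord_widen M (fun i => val (e i) * b ^+ i) nM) big_mkcond.
apply: eq_bigr => i _; case: ltnP => // ni.
by rewrite e0 ?mul0r.
Qed.

Lemma mem_sumset x y : x \in A -> y \in A -> x + y \in sumset A A.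
Proof. by move=> Ax Ay; apply/imfset2P; exists x => //; exists y. Qed.

(** Without anticipation the digit at [j] is computed from positions [j - r] to
    [j], so the support stays to the right of 0 and grows by at most [r] to the
    left of the most significant digit, once the zero window is known to
    produce the digit 0. *)
Lemma local_supported (B : {fset R[i]}) (f : (int -> B) -> (int -> A)) r :
  0 \in B -> digit_set_conversion b f -> is_local_with r 0 f ->
  forall N w, supported B N w -> supported A (N + r) (f w).
Proof.
move=> B0 fP [phi hphi] N w sw.
pose z0 := phi [tuple [` B0]%fset | i < r + 0 + 1].
have f0 j : f (fun=> [` B0]%fset) j = z0.
  by rewrite hphi; congr phi; apply: eq_from_tnth => i; rewrite !tnth_mktuple.
have z00 : val z0 = 0.
  have [|fin _] := fP (fun=> [` B0]%fset).
    rewrite /finitely_many_nonzero (_ : [set _ | _]%classic = set0) //.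
    by apply/seteqP; split=> // j /=; rewrite eqxx.
  apply: contrapT => /eqP nz; apply: infinite_nat.
  (* Otherwise the image of the zero word would be nonzero at every position. *)
  suff sub : ([set: nat] `<=` absz @` [set j | val (f (fun=> [` B0]%fset) j) != 0%R])%classic.
    by apply: (sub_finite_set sub (finite_image absz fin)).
  by move=> i _; exists i%:Z => //; rewrite /= f0.
move=> j jN; rewrite hphi -[RHS]z00; congr (val (phi _)).
apply: eq_from_tnth => i; rewrite !tnth_mktuple; apply: val_inj => /=.
apply: sw; apply: contra jN.
case: i => i /=; rewrite addn0 addn1 ltnS addr0 => ir.
case/andP=> ji1 ji2; apply/andP; split.
  by rewrite (le_trans ji1) // gerBl.
by rewrite ltrBlDr in ji2; rewrite (lt_le_trans ji2) // PoszD lerD2l lez_nat.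
Qed.

(** Add the digits position by position over [A + A], then convert back to [A]:
    the converted word still has no digit at a negative position. *)
Lemma expansions_add x y : allows_parallel_addition_without_anticipation b A ->
  in_base_expansions A b x -> in_base_expansions A b y ->
  in_base_expansions A b (x + y).
Proof.
case=> f [[fP _] [r fl]].
case/expansion_digits=> N1 [d1 [z1 hx]]; case/expansion_digits=> N2 [d2 [z2 hy]].
have S0 : 0 \in sumset A A by rewrite -[0]addr0 mem_sumset.
pose w (j : int) : sumset A A :=
  if j is Posz i then [` mem_sumset _ _ (valP (d1 i)) (valP (d2 i))]%fset
  else [` S0]%fset.
(* The length is N.+1 because an expansion has at least one digit. *)
pose N := maxn N1 N2.
have sw : supported _ N.+1 w.
  case=> // i; rewrite lez_nat ltz_nat /= -leqNgt => /ltnW; rewrite geq_max.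
  by case/andP=> N1i N2i; rewrite z1 // z2 // addr0.
have sfw := local_supported _ _ _ S0 fP fl _ _ sw.
have [|_ ww] := fP w.
  rewrite /finitely_many_nonzero; apply: (sub_finite_set _ (finite_image Posz (finite_II N.+1))).
  move=> j /= /eqP wj; have : 0 <= j < N.+1%:Z by apply: contraT => /sw.
  by case: j {wj} => // i iN; exists i.
exists (N + r)%N, (fun i => f w i%:Z).
rewrite -(word_value_supported _ _ _ sfw) -ww (word_value_supported _ _ _ sw).
rewrite (hx N.+1) ?leqW ?leq_maxl // (hy N.+1) ?leqW ?leq_maxr // -big_split.
by apply: eq_bigr => i _; rewrite /= mulrDl.
Qed.

Lemma expansions_nat n : allows_parallel_addition_without_anticipation b A ->
  in_base_expansions A b 1 -> in_base_expansions A b n%:R.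
Proof.
move=> par one; elim: n => [|n IHn]; last by rewrite -natr1; apply: expansions_add.
exists 0%N, (fun=> [` A0]%fset).
by rewrite big1 // => i _; rewrite mul0r.
Qed.

End Digits.

(** * Expanding bases *)

Theorem corollary3p6 (R : realType) (beta : R[i]) (A : {fset R[i]})
  (hsys : numeration_system beta A)
  (h1 : in_base_expansions A beta 1)
  (hA : forall a : R[i], a \in A -> in_Zadjoin beta a)
  (hpar : allows_parallel_addition_without_anticipation beta A) :
  expanding beta.
Proof.
case: hsys => beta1 A0.
have ge1 g : specialization _ beta g -> 1 <= `|g|.
  by apply: specialization_norm_ge1 hA _ => n; apply: expansions_nat.
split.
  apply: contrapT => transc; have /ge1 : specialization _ beta 0.
    move=> q qb; have [->|q0] := eqVneq q 0; first by rewrite rmorph0 root0.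
    by case: transc; exists q.
  by rewrite normr0 ler10.
move=> g [p [/monic_neq0 p0 pb min] pg].
have sp := minimal_specialization _ _ _ _ p0 pb min.
have g1 := ge1 g (sp g pg).
rewrite lt_neqAle g1 andbT; apply/eqP => /esym gE.
have g0 : g != 0 by rewrite -normr_eq0 gE oner_eq0.
have b0 : beta != 0 by rewrite -normr_eq0 gt_eqF // (lt_trans ltr01).
(* On the unit circle the inverse is the complex conjugate. *)
have pgV : root (map_poly ratr p) g^-1.
  suff -> : g^-1 = g^* by apply: conj_root.
  by apply: (mulfI g0); rewrite divff // -normCK gE expr1n.
have pbV : root (map_poly ratr p) beta^-1.
  rewrite -(reciprocal_root _ p _ b0).
  by apply: (minimal_specialization_sym _ _ _ _ p0 pb min pg); rewrite (reciprocal_root _ p _ g0).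
have := ge1 _ (sp _ pbV).
by rewrite normfV invf_ge1 ?normr_gt0 // lt_geF.
Qed.
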